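(* Let $\phi:\{0,1\}^n\to\mathbb{C}^{2^m}$, $x\mapsto|\phi_x\rangle$, be an $(n,m,\delta)$ quantum fingerprinting, and let $\eta_{XY}=\sum_{x,y}p_{x,y}|x\rangle\langle x|\otimes|y\rangle\langle y|$ be a classical joint distribution with $X$ uniform on $\{0,1\}^n$ and with leakage $\ell=n-H_{\min}(X|Y)_\eta$, so that $p_g:=p_g(X|Y)_\eta=2^{\ell-n}$. Then for every forgery state $\rho_{XE}$ obtained from $\eta_{XY}$ by a quantum channel acting on the $Y$ register only, the probability $e_s=\mathrm{Tr}(V\rho_{XE})$ of passing the verification scheme $V$ for $\phi$ satisfies $$e_s\le p_g+\delta.$$
   Context: An $(n,m,\delta)$ quantum fingerprinting ($n\ge1$) is a map $x\mapsto|\phi_x\rangle$ from $\{0,1\}^n$ to unit vectors of $\mathbb{C}^{2^m}$ with $\delta=\max_{x\neq x'}|\langle\phi_x|\phi_{x'}\rangle|$. $p_g(X|Y)_\eta=\sum_y\max_xp_{x,y}$ and $H_{\min}(X|Y)_\eta=-\log_2p_g(X|Y)_\eta$; $Y$ takes values in a finite set. A forgery state has the form $\rho_{XE}=\sum_{x,y}p_{x,y}|x\rangle\langle x|\otimes\sigma_y$ with $m$-qubit density operators $\sigma_y$. The verification scheme is the measurement operator $V=\sum_x|x\rangle\langle x|\otimes|\phi_x\rangle\langle\phi_x|$, so $e_s=\sum_{x,y}p_{x,y}\langle\phi_x|\sigma_y|\phi_x\rangle$. *)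

(* Defs.v *)
From HB Require Import structures.
From mathcomp Require Import all_boot all_order all_algebra.
From mathcomp Require Import complex mxtens.
From mathcomp Require Import reals exp.

Set Implicit Arguments.
Unset Strict Implicit.
Unset Printing Implicit Defensive.

Import Order.TTheory GRing.Theory Num.Theory.

Local Open Scope ring_scope.
Local Open Scope complex_scope.

Definition adjmx (R : realType) (a b : nat) (A : 'M[R[i]]_(a, b)) :
    'M[R[i]]_(b, a) :=
  map_mx (@conjc R) A^T.

Definition braket (R : realType) (d : nat) (u v : 'cV[R[i]]_d) : R[i] :=
  (adjmx u *m v) 0 0.

Definition projector (R : realType) (d : nat) (u : 'cV[R[i]]_d) : 'M[R[i]]_d :=
  u *m adjmx u.

(* A classical register with alphabet T is the space of dimension #|T|, whose
   standard basis is indexed by T through [enum_rank]. *)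
Definition ket (R : realType) (T : finType) (t : T) : 'cV[R[i]]_#|T| :=
  delta_mx (enum_rank t) 0.

(* In the order of R[i], [0 <= z] means that z is real and nonnegative, so
   this condition forces A to be Hermitian. *)
Definition possemidef (R : realType) (d : nat) (A : 'M[R[i]]_d) : Prop :=
  forall v : 'cV[R[i]]_d, 0 <= (adjmx v *m A *m v) 0 0.

(* The (i, j) block of an operator on C^k (x) C^d. *)
Definition tens_block (R : realType) (k d : nat) (A : 'M[R[i]]_(k * d))
    (i j : 'I_k) : 'M[R[i]]_d :=
  \matrix_(a, b) A (mxtens_index (i, a)) (mxtens_index (j, b)).

(* The map id_k (x) L. *)
Definition ampliation (R : realType) (k d e : nat)
    (L : 'M[R[i]]_d -> 'M[R[i]]_e) (A : 'M[R[i]]_(k * d)) :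
    'M[R[i]]_(k * e) :=
  \sum_(i < k) \sum_(j < k) (delta_mx i j *t L (tens_block A i j)).

Definition completely_positive (R : realType) (d e : nat)
    (L : 'M[R[i]]_d -> 'M[R[i]]_e) : Prop :=
  forall (k : nat) (A : 'M[R[i]]_(k * d)),
    possemidef A -> possemidef (ampliation L A).

Definition trace_preserving (R : realType) (d e : nat)
    (L : 'M[R[i]]_d -> 'M[R[i]]_e) : Prop :=
  forall A : 'M[R[i]]_d, \tr (L A) = \tr A.

Definition quantum_channel (R : realType) (d e : nat)
    (L : {linear 'M[R[i]]_d -> 'M[R[i]]_e}) : Prop :=
  completely_positive L /\ trace_preserving L.

Definition bits (n : nat) : finType := n.-tuple bool.

(* For n >= 1 the range of the maximum is nonempty, and the moduli are
   nonnegative, so the default value 0 is harmless. *)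
Definition max_overlap (R : realType) (n m : nat)
    (phi : bits n -> 'cV[R[i]]_(2 ^ m)) : R :=
  \big[Num.max/0]_(xx : bits n * bits n | xx.1 != xx.2)
     ComplexField.Normc.normc (braket (phi xx.1) (phi xx.2)).

Definition quantum_fingerprinting (R : realType) (n m : nat) (delta : R)
    (phi : bits n -> 'cV[R[i]]_(2 ^ m)) : Prop :=
  [/\ (1 <= n)%N,
      forall x, braket (phi x) (phi x) = 1 &
      delta = max_overlap phi].

Definition joint_distribution (R : realType) (X Y : finType)
    (p : X -> Y -> R) : Prop :=
  (forall x y, 0 <= p x y) /\ \sum_x \sum_y p x y = 1.

Definition uniform_marginal (R : realType) (X Y : finType)
    (p : X -> Y -> R) : Prop :=
  forall x, \sum_y p x y = #|X|%:R^-1.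

(* The entries of p are nonnegative, so the default value 0 of the maximum is
   harmless. *)
Definition guessing_prob (R : realType) (X Y : finType) (p : X -> Y -> R) : R :=
  \sum_y \big[Num.max/0]_x p x y.

Definition log2 (R : realType) (r : R) : R := ln r / ln 2.

Definition min_entropy (R : realType) (X Y : finType) (p : X -> Y -> R) : R :=
  - log2 (guessing_prob p).

Definition leakage (R : realType) (n : nat) (Y : finType)
    (p : bits n -> Y -> R) : R :=
  n%:R - min_entropy p.

Definition classical_state (R : realType) (X Y : finType) (p : X -> Y -> R) :
    'M[R[i]]_(#|X| * #|Y|) :=
  \sum_x \sum_y ((p x y)%:C *: (projector (ket R x) *t projector (ket R y))).

Definition forgery_state (R : realType) (n m : nat) (Y : finType)
    (p : bits n -> Y -> R) (rho : 'M[R[i]]_(#|bits n| * 2 ^ m)) : Prop :=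
  exists L : {linear 'M[R[i]]_#|Y| -> 'M[R[i]]_(2 ^ m)},
    quantum_channel L /\ rho = ampliation L (classical_state p).

Definition verification (R : realType) (n m : nat)
    (phi : bits n -> 'cV[R[i]]_(2 ^ m)) : 'M[R[i]]_(#|bits n| * 2 ^ m) :=
  \sum_x (projector (ket R x) *t projector (phi x)).

(* The trace is kept in R[i]: the inequality [pass_prob phi rho <= r%:C] also
   says that it is real. *)
Definition pass_prob (R : realType) (n m : nat)
    (phi : bits n -> 'cV[R[i]]_(2 ^ m))
    (rho : 'M[R[i]]_(#|bits n| * 2 ^ m)) : R[i] :=
  \tr (verification phi *m rho).

(* Main.v *)
(* The pass probability is the sum over x, y of p_{x,y} <phi_x|sigma_y|phi_x>,
   where sigma_y is the image of |y><y| under the channel, a positive operator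
   of trace 1.  For a fixed y, the operator sum_x p_{x,y} |phi_x><phi_x| is
   bounded by max_x p_{x,y} + delta sum_x p_{x,y}: it has the same norm as the
   Gram matrix with entries sqrt(p_{x,y} p_{x',y}) <phi_x|phi_x'>, whose
   diagonal part contributes the first term and off-diagonal part the second.
   Summing over y gives p_g + delta. *)
From HB Require Import structures.
Require Import Defs.
From mathcomp Require Import all_boot all_order all_algebra.
From mathcomp Require Import complex mxtens.
From mathcomp Require Import spectral sesquilinear ring lra.
From mathcomp Require Import reals exp.

Import Order.TTheory GRing.Theory Num.Theory.

Local Open Scope ring_scope.
Local Open Scope complex_scope.

(** * Brackets, projectors and traces *)

Section Braket.
Variables (R : realType) (d : nat).
Implicit Types (u v w : 'cV[R[i]]_d) (c : R[i]).

Lemma braketE u v : braket u v = \sum_k (u k 0)^*%R * v k 0.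
Proof. by rewrite /braket mxE; apply: eq_bigr => k _; rewrite !mxE. Qed.

Lemma braketC u v : braket u v = (braket v u)^*%R.
Proof.
rewrite !braketE rmorph_sum; apply: eq_bigr => k _ /=.
by rewrite rmorphM /= conjCK mulrC.
Qed.

Lemma braketDr u v w : braket u (v + w) = braket u v + braket u w.
Proof. by rewrite /braket mulmxDr mxE. Qed.

Lemma braketZr c u v : braket u (c *: v) = c * braket u v.
Proof. by rewrite /braket -scalemxAr mxE. Qed.

Lemma braketDl u v w : braket (u + v) w = braket u w + braket v w.
Proof. by rewrite braketC braketDr rmorphD /= -!braketC. Qed.

Lemma braketZl c u v : braket (c *: u) v = c^*%R * braket u v.
Proof. by rewrite braketC braketZr rmorphM /= -braketC. Qed.

Lemma braket_sumr (T : finType) (F : T -> 'cV[R[i]]_d) u :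
  braket u (\sum_x F x) = \sum_x braket u (F x).
Proof. by rewrite /braket mulmx_sumr summxE. Qed.

Lemma braket_suml (T : finType) (F : T -> 'cV[R[i]]_d) u :
  braket (\sum_x F x) u = \sum_x braket (F x) u.
Proof.
by rewrite braketC braket_sumr rmorph_sum; apply: eq_bigr => x _ /=; rewrite -braketC.
Qed.

Lemma braket_ge0 u : 0 <= braket u u.
Proof.
by rewrite braketE sumr_ge0 // => k _; rewrite mulrC -normCK exprn_ge0.
Qed.

Lemma projector_form u v :
  (adjmx v *m projector u *m v) 0 0 = `|braket v u| ^+ 2.
Proof.
rewrite /projector !mulmxA -mulmxA mxE big_ord1 -!/(braket _ _).
by rewrite normCK -braketC.
Qed.

Lemma projector_psd u : possemidef (projector u).
Proof. by move=> v; rewrite projector_form exprn_ge0. Qed.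

Lemma mxtrace_projectorM u (A : 'M[R[i]]_d) :
  \tr (projector u *m A) = (adjmx u *m A *m u) 0 0.
Proof. by rewrite /projector -mulmxA mxtrace_mulC trace_mx11. Qed.

Lemma mxtrace_projector u : \tr (projector u) = braket u u.
Proof. by rewrite -[projector u]mulmx1 mxtrace_projectorM mulmx1. Qed.

End Braket.

Lemma braket_ket (R : realType) (T : finType) (s t : T) :
  braket (ket R s) (ket R t) = (s == t)%:R.
Proof.
rewrite braketE (bigD1 (enum_rank s)) //= big1 ?addr0; last first.
  by move=> k ks; rewrite !mxE (negPf ks) rmorph_nat mul0r.
by rewrite !mxE !eqxx (inj_eq enum_rank_inj) rmorph_nat mul1r andbT.
Qed.

Lemma mxtrace_tens (R : comPzRingType) (m n : nat) (A : 'M[R]_m) (B : 'M[R]_n) :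
  \tr (A *t B) = \tr A * \tr B.
Proof. by rewrite /mxtrace mulr_sum; apply: eq_bigr => k _; rewrite mxE. Qed.

(** * Ampliation of a linear map *)

Section Ampliation.
Variables (R : realType) (d e : nat) (L : {linear 'M[R[i]]_d -> 'M[R[i]]_e}).

(** The [(i, j)] block of [A *t B] is [A i j *: B], so at an entry [(r, s)] of the double sum only
    the pair of block indices carried by [r] and [s] survives. *)
Lemma ampliation_tens k (A : 'M[R[i]]_k) (B : 'M[R[i]]_d) :
  ampliation L (A *t B) = A *t L B.
Proof.
have blockE i j : tens_block (A *t B) i j = A i j *: B.
  by apply/matrixP => a b; rewrite mxE tensmxE mxE.
apply/matrixP => r s; rewrite /ampliation summxE mxE.
set i := (mxtens_unindex r).1; set j := (mxtens_unindex s).1.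
rewrite (bigD1 i) //= [X in _ + X]big1 ?addr0 => [|i' ni]; last first.
  rewrite summxE big1 // => j' _.
  by rewrite !mxE -/i eq_sym (negPf ni) mul0r.
rewrite summxE (bigD1 j) //= [X in _ + X]big1 ?addr0 => [|j' nj]; last first.
  by rewrite !mxE -/j [j == _]eq_sym (negPf nj) andbF mul0r.
by rewrite mxE mxE -/i -/j !eqxx mul1r blockE linearZ mxE.
Qed.

(** Lets the ampliation pass through the sums and scalars of [classical_state]. *)
Lemma ampliation_is_linear k : linear (ampliation L : 'M_(k * d) -> 'M_(k * e)).
Proof.
move=> c A B; rewrite /ampliation scaler_sumr -big_split; apply: eq_bigr => i _ /=.
rewrite scaler_sumr -big_split; apply: eq_bigr => j _ /=.
have -> : tens_block (c *: A + B) i j = c *: tens_block A i j + tens_block B i j.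
  by apply/matrixP => a b; rewrite !mxE.
by rewrite linearP; apply/matrixP => a b; rewrite !mxE mulrDr mulrCA.
Qed.

HB.instance Definition _ k := GRing.isLinear.Build _ _ _ _
  (ampliation L : 'M_(k * d) -> 'M_(k * e)) (@ampliation_is_linear k).

Lemma possemidef_castmx n n' (eqn : n = n') (A : 'M[R[i]]_n) :
  possemidef (castmx (eqn, eqn) A) <-> possemidef A.
Proof. by case: _ / eqn; rewrite castmx_id. Qed.

(** Complete positivity is taken at [k = 1], where [1 *t A] is [A] up to a cast of dimensions. *)
Lemma completely_positive_psd (A : 'M[R[i]]_d) :
  completely_positive L -> possemidef A -> possemidef (L A).
Proof.
move=> cpL psdA; have := cpL 1 (1 *t A).
by rewrite ampliation_tens !tens_scalar1mx !possemidef_castmx; apply.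
Qed.

End Ampliation.

Lemma braket_mulmx (R : realType) (d : nat) (A : 'M[R[i]]_d) (u v : 'cV[R[i]]_d) :
  braket u (A *m v) = (adjmx u *m A *m v) 0 0.
Proof. by rewrite /braket mulmxA. Qed.

(** * Spectral decomposition of positive operators *)

Section Spectral.
Variables (R : realType) (d : nat) (A : 'M[R[i]]_d).

Lemma braket_delta i j :
  braket (delta_mx i 0) (A *m delta_mx j 0) = A i j.
Proof.
rewrite -colE braketE (bigD1 i) //= big1 ?addr0 => [|k nki].
  by rewrite !mxE !eqxx rmorph_nat mul1r.
by rewrite mxE (negPf nki) rmorph_nat mul0r.
Qed.

(** Polarization: the form of [A] is real at [u], [v], [u + v] and [u + 'i *: v]. The third vector
    makes the imaginary parts of the two cross terms opposite, the fourth makes their real parts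
    equal. *)
Lemma possemidef_polar (u v : 'cV[R[i]]_d) :
  possemidef A -> braket u (A *m v) = (braket v (A *m u))^*%R.
Proof.
move=> psdA.
have real_form w : complex.Im (braket w (A *m w)) = 0.
  by have := psdA w; rewrite -braket_mulmx lecE => /andP[/eqP].
have := real_form (u + v); have := real_form (u + 'i *: v).
rewrite !(mulmxDr, braketDl, braketDr, braketZl, braketZr, =^~ scalemxAr).
have := real_form u; have := real_form v.
case: (braket u (A *m u)) => uu1 uu2; case: (braket v (A *m v)) => vv1 vv2.
case: (braket u (A *m v)) => uv1 uv2; case: (braket v (A *m u)) => vu1 vu2 /=.
move=> -> -> H1 H2; congr (_ +i* _); lra.
Qed.

Lemma possemidef_hermitian : possemidef A -> A \is hermsymmx.
Proof.
move=> psdA; apply/is_hermitianmxP; rewrite expr0 scale1r.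
by apply/matrixP => i j; rewrite !mxE -!braket_delta; apply: possemidef_polar.
Qed.

Lemma possemidef_spectral :
  possemidef A ->
  exists (c : 'I_d -> R[i]) (u : 'I_d -> 'cV[R[i]]_d),
    (forall k, 0 <= c k) /\ A = \sum_k c k *: projector (u k).
Proof.
move=> psdA.
have /hermitian_normalmx/orthomx_spectralP := possemidef_hermitian psdA.
set P := spectralmx A; set D := spectral_diag A => defA.
have Puni : P \is unitarymx by apply: spectral_unitarymx.
(* The spectral theorem gives [A] as the adjoint of [P] times [diag_mx D] times [P], so the
   eigenvectors are the adjoints of the rows of [P]. *)
exists (fun k => D 0 k), (fun k => adjmx (row k P)).
have defA' : A = \sum_k D 0 k *: projector (adjmx (row k P)).
  rewrite {1}defA invmx_unitary //; apply/matrixP => i j.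
  rewrite mxE summxE; apply: eq_bigr => k _.
  rewrite mul_mx_diag /projector !mxE big_ord1 !mxE conjcK.
  by rewrite mulrAC mulrC mulrA.
split => // k.
have orth l : braket (adjmx (row k P)) (adjmx (row l P)) = (k == l)%:R.
  have := congr1 (fun M : 'M_d => M k l) (unitarymxP Puni); rewrite !mxE => <-.
  by rewrite braketE; apply: eq_bigr => j _; rewrite !mxE conjCK.
(* The rows being orthonormal, the form of [A] at the eigenvector number [k] is exactly [D 0 k]. *)
have := psdA (adjmx (row k P)).
rewrite {1}defA' mulmx_sumr mulmx_suml summxE (bigD1 k) //= [X in _ + X]big1.
  rewrite addr0 -scalemxAr -scalemxAl mxE projector_form orth eqxx.
  by rewrite normr1 expr1n mulr1.
move=> l nlk; rewrite -scalemxAr -scalemxAl mxE projector_form orth.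
by rewrite eq_sym (negPf nlk) normr0 expr0n mulr0.
Qed.

End Spectral.

(** * A frame bound for weighted, nearly orthogonal unit vectors *)

Section Frame.
Variables (R : realType) (T : finType) (d : nat) (phi : T -> 'cV[R[i]]_d).
Variables (w : T -> R) (M delta : R).
Hypotheses (M_ge0 : 0 <= M) (delta_ge0 : 0 <= delta).
Hypotheses (w_ge0 : forall x, 0 <= w x) (w_le : forall x, w x <= M).
Hypothesis unit_phi : forall x, braket (phi x) (phi x) = 1.
Hypothesis overlap_phi : forall x y, x != y ->
  `|braket (phi x) (phi y)| <= delta%:C.

(** This is the weighted Cauchy-Schwarz inequality for the square of the sum of [w x * |a x|],
    obtained from the arithmetic-geometric mean inequality on each pair. *)
Lemma sum_outer_le (a : T -> R[i]) :
  \sum_x \sum_y (w x * w y)%:C * (`|a x| * `|a y|) <=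
  (\sum_x w x)%:C * \sum_x (w x)%:C * `|a x| ^+ 2.
Proof.
have amgm (x y : T) : `|a x| * `|a y| <= (`|a x| ^+ 2 + `|a y| ^+ 2) / 2.
  rewrite ler_pdivlMr ?ltr0n // -subr_ge0.
  have -> : `|a x| ^+ 2 + `|a y| ^+ 2 - `|a x| * `|a y| * 2 = (`|a x| - `|a y|) ^+ 2.
    by ring.
  (* In [R[i]] a square is nonnegative only if its base is real, as a difference of norms is. *)
  by rewrite real_exprn_even_ge0 // realB // normr_real.
have le1 : \sum_x \sum_y (w x * w y)%:C * (`|a x| * `|a y|) <=
    \sum_x \sum_y (w x * w y)%:C * ((`|a x| ^+ 2 + `|a y| ^+ 2) / 2).
  apply: ler_sum => x _; apply: ler_sum => y _; apply: ler_wpM2l (amgm x y).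
  by rewrite lecR mulr_ge0.
apply: le_trans le1 _; rewrite le_eqVlt; apply/orP; left; apply/eqP.
(* By exchanging the sums, the halves with [|a x|] and [|a y|] both total [S / 2]. *)
pose S := \sum_x \sum_y ((w x)%:C * (w y)%:C) * `|a x| ^+ 2.
have SE : (\sum_x w x)%:C * \sum_x (w x)%:C * `|a x| ^+ 2 = S.
  rewrite rmorph_sum /= mulrC mulr_suml; apply: eq_bigr => x _.
  by rewrite mulr_sumr; apply: eq_bigr => y _; ring.
have SE' : S = \sum_x \sum_y ((w x)%:C * (w y)%:C) * `|a y| ^+ 2.
  rewrite /S exchange_big; apply: eq_bigr => x _; apply: eq_bigr => y _ /=.
  by rewrite [(w y)%:C * _]mulrC.
have -> : (\sum_x w x)%:C * \sum_x (w x)%:C * `|a x| ^+ 2 = (S + S) / 2.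
  by rewrite SE; field.
rewrite {2}SE' /S -big_split mulr_suml; apply: eq_bigr => x _ /=.
rewrite -big_split mulr_suml; apply: eq_bigr => y _ /=.
by rewrite rmorphM /=; ring.
Qed.

Section Synthesis.
Variable u : 'cV[R[i]]_d.
Let a x := braket (phi x) u.
Let S := \sum_x (w x)%:C * `|a x| ^+ 2.
Let c := (M + delta * \sum_x w x)%:C.
(** The vector [v] is the frame operator, the sum of [w x] times the projector on [phi x], applied
    to [u]; [S] is its quadratic form at [u], and [c] is the claimed bound on its norm. *)
Let v := \sum_x ((w x)%:C * a x) *: phi x.

Lemma braket_synthesis : braket v u = S.
Proof.
rewrite braket_suml; apply: eq_bigr => x _.
rewrite braketZl rmorphM /= [((w x)%:C)^*%R]conjc_real -/(a x).
by rewrite -mulrA [_ * a x]mulrC -normCK.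
Qed.

(** Expand [<v|v>] over pairs. Diagonal terms have weight [w x * w x], at most [M * w x], and yield
    [M * S]; the others carry an overlap of at most [delta] and are summed by [sum_outer_le]. *)
Lemma synthesis_le : braket v v <= c * S.
Proof.
rewrite -[leLHS]ger0_norm ?braket_ge0 //.
rewrite braket_suml; apply: le_trans (ler_norm_sum _ _ _) _.
have term x y : `|braket (((w x)%:C * a x) *: phi x) (((w y)%:C * a y) *: phi y)| <=
   (x == y)%:R * (w x * w x)%:C * `|a x| ^+ 2 + delta%:C * ((w x * w y)%:C * (`|a x| * `|a y|)).
  rewrite braketZl braketZr !normrM norm_conjC normrM.
  have normW z : `|(w z)%:C| = (w z)%:C by rewrite ger0_norm // lecR.
  rewrite !normW !rmorphM /=.
  (* A nonnegative [delta] term is also granted to the diagonal pairs, so that the [delta] part is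
     the full double sum of [sum_outer_le]. *)
  have D0 z : 0 <= delta%:C * ((w x)%:C * (w z)%:C * (`|a x| * `|a z|)).
    by rewrite !mulr_ge0 ?normr_ge0 ?lecR.
  have [<-|nxy] := eqVneq x y.
    rewrite unit_phi normr1 mul1r -[leLHS]addr0 lerD //.
    by rewrite le_eqVlt; apply/orP; left; apply/eqP; ring.
  rewrite !mul0r add0r.
  apply: (@le_trans _ _ (((w x)%:C * (w y)%:C * (`|a x| * `|a y|)) *
    `|braket (phi x) (phi y)|)).
    by rewrite le_eqVlt; apply/orP; left; apply/eqP; ring.
  by rewrite [leRHS]mulrC ler_wpM2l ?overlap_phi // !mulr_ge0 ?normr_ge0 ?lecR.
have row_le x : `|braket (((w x)%:C * a x) *: phi x) v| <=
    \sum_y ((x == y)%:R * (w x * w x)%:C * `|a x| ^+ 2 +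
     delta%:C * ((w x * w y)%:C * (`|a x| * `|a y|))).
  by rewrite braket_sumr; apply: le_trans (ler_norm_sum _ _ _) _; exact: ler_sum.
apply: le_trans (ler_sum _ (fun x _ => row_le x)) _.
under eq_bigr do rewrite big_split -mulr_sumr.
rewrite big_split -mulr_sumr /= /c rmorphD rmorphM /= mulrDl lerD //.
  rewrite /S mulr_sumr; apply: ler_sum => x _.
  rewrite (bigD1 x) //= big1 => [|y nyx]; last by rewrite eq_sym (negPf nyx) !mul0r.
  rewrite eqxx mul1r addr0 mulrA ler_wpM2r ?exprn_ge0 //.
  by rewrite rmorphM ler_wpM2r ?lecR.
by rewrite -mulrA ler_wpM2l ?lecR // sum_outer_le.
Qed.

(* With [S] the left-hand side, [v] satisfies [<v|u> = S] and [<v|v> <= c S],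
   so [0 <= <u - v/c|u - v/c>] gives [S <= c <u|u>]. *)
Lemma frame_bound : S <= c * braket u u.
Proof.
have W_ge0 : 0 <= \sum_x w x by apply: sumr_ge0.
have c_ge0 : 0 <= c by rewrite lecR addr_ge0 ?mulr_ge0.
(* The vector [u - v/c] needs [c] nonzero. If [c] is zero then so is [M], hence every weight and
   [S]. *)
have [c0|c_neq0] := eqVneq c 0.
  have M0 : M = 0.
    apply/eqP; have /complexI/eqP : c = 0%:C by [].
    by rewrite paddr_eq0 ?mulr_ge0 // => /andP[].
  rewrite c0 mul0r /S big1 // => x _.
  have -> : w x = 0 by apply/eqP; rewrite eq_le w_ge0 -M0 w_le.
  by rewrite mul0r.
have c_gt0 : 0 < c by rewrite lt_def c_neq0.
have S_real : S^*%R = S.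
  apply: conj_Creal; rewrite ger0_real // sumr_ge0 // => x _.
  by rewrite mulr_ge0 ?lecR ?exprn_ge0.
have cV_real : (- c^-1)^*%R = - c^-1.
  by apply: conj_Creal; rewrite rpredN ger0_real // invr_ge0.
have := @braket_ge0 R d (u + (- c^-1) *: v).
rewrite !(braketDl, braketDr, braketZl, braketZr) cV_real.
rewrite [braket u v]braketC braket_synthesis S_real => h.
rewrite -ler_pdivrMl // -subr_ge0; apply: le_trans h _; rewrite -subr_ge0.
move: (braket u u) (braket v v) synthesis_le => U V leV.
(* The gap between [U - S/c] and the expanded square is [(c S - V) / c^2], nonnegative by
   [synthesis_le]. *)
have square (F : fieldType) (k s t z : F) : k != 0 ->
    t - k^-1 * s - (t + - k^-1 * s + (- k^-1 * s + - k^-1 * (- k^-1 * z))) =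
    k^-1 ^+ 2 * (k * s - z) by move=> k_neq0; field.
rewrite square //.
by rewrite mulr_ge0 ?exprn_ge0 ?invr_ge0 // subr_ge0.
Qed.

End Synthesis.

(** Both sides are linear in [A], so [frame_bound] at each eigenvector, weighted by its nonnegative
    eigenvalue, suffices. It serves at a fixed [y], with [w x] being [p x y] and [M] its maximum
    over [x]. *)
Lemma psd_frame_bound (A : 'M[R[i]]_d) : possemidef A ->
  \sum_x (w x)%:C * \tr (projector (phi x) *m A) <=
  (M + delta * \sum_x w x)%:C * \tr A.
Proof.
case/possemidef_spectral => r [u [r_ge0 ->]].
have -> : \sum_x (w x)%:C * \tr (projector (phi x) *m \sum_k r k *: projector (u k)) =
    \sum_k r k * \sum_x (w x)%:C * `|braket (phi x) (u k)| ^+ 2.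
  under [RHS]eq_bigr do rewrite mulr_sumr.
  rewrite exchange_big; apply: eq_bigr => x _ /=.
  rewrite mulmx_sumr raddf_sum mulr_sumr; apply: eq_bigr => k _ /=.
  by rewrite -scalemxAr mxtraceZ mxtrace_projectorM projector_form mulrCA.
rewrite raddf_sum mulr_sumr; apply: ler_sum => k _ /=.
by rewrite mxtraceZ mxtrace_projector mulrCA ler_wpM2l // frame_bound.
Qed.

End Frame.

(** * Maximal overlap and guessing probability *)

Lemma max_overlap_ge0 (R : realType) (n m : nat) (phi : bits n -> 'cV[R[i]]_(2 ^ m)) :
  0 <= max_overlap phi.
Proof. exact: bigmax_ge_id. Qed.

Lemma overlap_le_max (R : realType) (n m : nat) (phi : bits n -> 'cV[R[i]]_(2 ^ m))
    (x y : bits n) :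
  x != y -> `|braket (phi x) (phi y)| <= (max_overlap phi)%:C.
Proof.
(* The norm of [R[i]] is the embedding of the real number [normc], so the comparison takes place in
   [R]. *)
move=> nxy; rewrite lecR.
exact: (@le_bigmax_cond _ _ _ _ (x, y) (fun xx : bits n * bits n => xx.1 != xx.2)
  (fun xx => ComplexField.Normc.normc (braket (phi xx.1) (phi xx.2)))).
Qed.

(** If the sum of maxima vanished, every [p x y] would, against total mass 1. Positivity is what
    allows the logarithm in the min-entropy to be inverted. *)
Lemma guessing_prob_gt0 (R : realType) (X Y : finType) (p : X -> Y -> R) :
  joint_distribution p -> 0 < guessing_prob p.
Proof.
case=> p_ge0 p1; rewrite lt_def sumr_ge0 ?andbT => [|y _]; last exact: bigmax_ge_id.
apply/eqP => g0; suff p0 x y : p x y = 0.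
  move: p1; rewrite big1 => [/eqP|x _]; last by rewrite big1.
  by rewrite eq_sym oner_eq0.
have /eqP := g0; rewrite psumr_eq0 => [/allP/(_ y (mem_index_enum _))/eqP maxy0|z _].
  by apply/eqP; rewrite eq_le p_ge0 -maxy0 andbT le_bigmax.
exact: bigmax_ge_id.
Qed.

Lemma powR2_log2 (R : realType) (r : R) : 0 < r -> 2 `^ (log2 r) = r.
Proof.
move=> r_gt0; rewrite /powR pnatr_eq0 /= /log2 divfK ?lnK //.
by rewrite gt_eqF // ln_gt0 // ltr1n.
Qed.

(** * Pass probability of a forgery and the final bound *)

Section Forgery.
Variables (R : realType) (n m : nat) (phi : bits n -> 'cV[R[i]]_(2 ^ m)).
Variables (Y : finType) (p : bits n -> Y -> R).
Variable L : {linear 'M[R[i]]_#|Y| -> 'M[R[i]]_(2 ^ m)}.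

Lemma ampliation_classical_state :
  ampliation L (classical_state p) =
  \sum_x \sum_y (p x y)%:C *: (projector (ket R x) *t L (projector (ket R y))).
Proof.
rewrite /classical_state raddf_sum; apply: eq_bigr => x _ /=.
rewrite raddf_sum; apply: eq_bigr => y _ /=.
by rewrite linearZ_LR /= ampliation_tens.
Qed.

(** The trace of a tensor product factors, and its classical factor [|<x|x'>|^2] keeps only
    [x = x']. The sum over [y] is outermost because the frame bound applies to each [y]
    separately. *)
Lemma pass_prob_forgery :
  pass_prob phi (ampliation L (classical_state p)) =
  \sum_y \sum_x (p x y)%:C * \tr (projector (phi x) *m L (projector (ket R y))).
Proof.
have termE x x' y : \tr (projector (ket R x) *t projector (phi x)
      *m ((p x' y)%:C *: (projector (ket R x') *t L (projector (ket R y))))) =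
    (x == x')%:R * ((p x' y)%:C * \tr (projector (phi x) *m L (projector (ket R y)))).
  rewrite -scalemxAr mxtraceZ tensmx_mul mxtrace_tens.
  rewrite (mxtrace_projectorM _ _ (ket R x)) projector_form braket_ket mulrCA.
  by case: eqP; rewrite ?normr0 ?normr1 ?expr1n ?expr0n.
rewrite exchange_big /pass_prob /verification ampliation_classical_state.
rewrite mulmx_suml raddf_sum; apply: eq_bigr => x _ /=.
rewrite mulmx_sumr raddf_sum (bigD1 x) //= [X in _ + X]big1 ?addr0 => [|x' nx].
  rewrite mulmx_sumr raddf_sum; apply: eq_bigr => y _ /=.
  by rewrite termE eqxx mul1r.
rewrite mulmx_sumr raddf_sum big1 // => y _ /=.
by rewrite termE eq_sym (negPf nx) mul0r.
Qed.

End Forgery.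

Theorem lemma1p4 (R : realType) (n m : nat) (delta : R)
    (phi : bits n -> 'cV[R[i]]_(2 ^ m)) (Y : finType) (p : bits n -> Y -> R)
    (ell : R) :
  quantum_fingerprinting delta phi ->
  joint_distribution p ->
  uniform_marginal p ->
  ell = leakage p ->
  guessing_prob p = 2 `^ (ell - n%:R) /\
  (forall rho : 'M[R[i]]_(#|bits n| * 2 ^ m),
     forgery_state p rho ->
     pass_prob phi rho <= (guessing_prob p + delta)%:C).
Proof.
move=> [_ unit_phi ->] jd _ ->; split.
  by rewrite /leakage /min_entropy opprK addrAC subrr add0r powR2_log2 ?guessing_prob_gt0.
move=> _ [L [[cpL tpL] ->]]; rewrite pass_prob_forgery.
have [p_ge0 p1] := jd.
(* The bound is split over [y]: total mass 1 distributes the overlap term, and each channel output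
   has trace 1, so the factor [\tr] may be inserted to match [psd_frame_bound]. *)
have -> : (guessing_prob p + max_overlap phi)%:C =
    \sum_y (\big[Num.max/0]_x p x y + max_overlap phi * \sum_x p x y)%:C
           * \tr (L (projector (ket R y))).
  rewrite -[max_overlap phi in LHS]mulr1 -p1 [in LHS]exchange_big mulr_sumr.
  rewrite -big_split rmorph_sum; apply: eq_bigr => y _.
  by rewrite tpL mxtrace_projector braket_ket eqxx mulr1.
apply: ler_sum => y _; apply: psd_frame_bound.
- exact: bigmax_ge_id.
- exact: max_overlap_ge0.
- by move=> x.
- by move=> x; apply: le_bigmax.
- exact: unit_phi.
- by move=> x x'; apply: overlap_le_max.
- by apply: completely_positive_psd => //; apply: projector_psd.
Qed.
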